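(* Let $n,k$ be integers with $n\geq 2$ and $n-1\geq k\geq 1$. There is a bijection between the set $\mathcal{S}_2(n,k)$ of nested sets of $\mathcal{P}_2(\{1,2,\dots,n\})$ with exactly $k$ elements and the set $\mathcal{T}_2(n+k-1,k)$ of partitions of $\{1,2,\dots,n+k-1\}$ into $k$ parts, each of cardinality greater than or equal to $2$.
   Context: $\mathcal{P}_2(\{1,2,\dots,n\})$ denotes the collection of all subsets of $\{1,2,\dots,n\}$ of cardinality at least $2$. For $n\ge 2$, a subset $S$ of $\mathcal{P}_2(\{1,2,\dots,n\})$ is called a nested set if $\{1,2,\dots,n\}\in S$ and for any $I,J\in S$ either $I\subset J$ or $J\subset I$ (inclusions not necessarily strict) or $I\cap J=\emptyset$. $\mathcal{S}_2(n,k)$ is the set of nested sets $S$ of $\mathcal{P}_2(\{1,2,\dots,n\})$ with $|S|=k$. $\mathcal{T}_2(n+k-1,k)$ is the set of (unordered) set partitions of $\{1,2,\dots,n+k-1\}$ into $k$ parts all of which have cardinality at least $2$. *)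

(* Defs.v *)
From mathcomp Require Import all_boot.

Set Implicit Arguments.
Unset Strict Implicit.
Unset Printing Implicit Defensive.

(* The ground set {1, ..., m} is represented by 'I_m = {0, ..., m - 1}. *)

Definition P2 (n : nat) : {set {set 'I_n}} := [set I : {set 'I_n} | 2 <= #|I|].

Definition nested_set (n : nat) (S : {set {set 'I_n}}) : bool :=
  [&& S \subset P2 n,
      [set: 'I_n] \in S &
      [forall I in S, forall J in S,
         [|| I \subset J, J \subset I | I :&: J == set0]]].

Definition S2 (n k : nat) : {set {set {set 'I_n}}} :=
  [set S : {set {set 'I_n}} | nested_set S & #|S| == k].

Definition T2 (m k : nat) : {set {set {set 'I_m}}} :=
  [set P : {set {set 'I_m}} |
    [&& partition P [set: 'I_m], #|P| == k & [forall B in P, 2 <= #|B|]]].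

(* Main.v *)
(* Both sides satisfy the recurrence
   a(n + 1, k) = k a(n, k) + (n + k - 1) a(n, k - 1), so they are equinumerous.
   Adding the singletons to a nested set S with k elements yields a rooted tree
   with n leaves and k internal nodes, each with at least two children. A new
   leaf is either attached to one of the k internal nodes of such a tree, or
   inserted together with a new internal node just above one of the n + k - 1
   nodes of a tree with k - 1 internal nodes. On the partition side, a new point
   of {1, ..., n + k} either joins one of the k blocks or forms a pair with one of
   the n + k - 1 other points. *)
Require Import Defs.
From mathcomp Require Import all_boot.
Set Implicit Arguments.
Unset Strict Implicit.
Unset Printing Implicit Defensive.

(** * Counting preliminaries *)

Lemma card_dep_pairs (T U : finType) (A : {set T}) (B : T -> {set U}) (c : nat) :
  {in A, forall a, #|B a| = c} ->
  #|[set p : T * U | (p.1 \in A) && (p.2 \in B p.1)]| = #|A| * c.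
Proof.
move=> Bc; rewrite -sum_nat_const -(eq_bigr _ Bc) -sum1_card.
under [RHS]eq_bigr do rewrite -sum1_card.
by rewrite pair_big_dep /=; apply: eq_bigl => p; rewrite inE.
Qed.

Lemma card_eq_bijective (T U : finType) :
  #|T| = #|U| -> exists f : T -> U, bijective f.
Proof.
move=> eTU; exists (fun x => enum_val (cast_ord eTU (enum_rank x))).
exists (fun y => enum_val (cast_ord (esym eTU) (enum_rank y))) => x.
  by rewrite enum_valK cast_ordK enum_rankK.
by rewrite enum_valK cast_ordKV enum_rankK.
Qed.

(** * Laminar families as trees: inserting and deleting a leaf *)

Section Laminar.
Variable T : finType.
Implicit Types (A I J K : {set T}) (L : {set {set T}}) (x : T).

Definition comparable_or_disjoint I J :=
  [|| I \subset J, J \subset I | I :&: J == set0].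

(* A laminar family is a rooted tree with leaf set A whose nodes, leaves included,
   are identified with the sets of leaves below them. *)
Definition laminar A L :=
  [&& [forall I in L, (I \subset A) && (I != set0)], A \in L,
      [forall a in A, [set a] \in L]
    & [forall I in L, forall J in L, comparable_or_disjoint I J]].

Lemma laminarP A L :
  reflect [/\ forall I, I \in L -> I \subset A /\ I != set0, A \in L,
              forall a, a \in A -> [set a] \in L
            & forall I J, I \in L -> J \in L -> comparable_or_disjoint I J]
          (laminar A L).
Proof.
apply: (iffP and4P) => [] [sub AL sing cod]; split=> //.
- by move=> I IL; apply/andP; apply: (forall_inP sub).
- by move=> a aA; apply: (forall_inP sing).
- by move=> I J IL JL; apply: (forall_inP (forall_inP cod _ IL)).
- by apply/forall_inP => I IL; apply/andP; apply: sub.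
- exact/forall_inP.
by apply/forall_inP => I IL; apply/forall_inP => J; apply: cod.
Qed.

(* Attaches the new leaf x at the node J: as a child of J if b is false, as a
   child of a new node x |: J placed just above J if b is true. *)
Definition insert_leaf x J (b : bool) L : {set {set T}} :=
  [set K : {set T} | if x \in K then (K :\ x == set0) || (K :\ x \in L) && (J \subset K)
           else (K \in L) && (~~ (J \subset K) || b && (K == J))].

(** These are the nonempty traces [K :\ x] of the nodes [K]. If [x] has a single sibling, its parent
    and that sibling have the same trace and merge, so this undoes both kinds of insertion. *)
Definition delete_leaf x L : {set {set T}} :=
  [set I : {set T} | [&& x \notin I, I != set0 & (I \in L) || (x |: I \in L)]].

Lemma comparable_or_disjointC I J : comparable_or_disjoint I J = comparable_or_disjoint J I.
Proof. by rewrite /comparable_or_disjoint setIC orbCA. Qed.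

Lemma comparable_or_disjoint_meet I J a :
  comparable_or_disjoint I J -> a \in I -> a \in J ->
  (I \subset J) \/ (J \subset I).
Proof.
case/or3P=> [||/eqP IJ0] aI aJ; [by left | by right |].
by have := in_set0 a; rewrite -IJ0 inE aI aJ.
Qed.

Lemma comparable_or_disjointD1 I J x :
  comparable_or_disjoint I J -> comparable_or_disjoint (I :\ x) (J :\ x).
Proof.
case/or3P=> [H|H|/eqP H]; rewrite /comparable_or_disjoint.
- by rewrite setSD.
- by rewrite (setSD _ H) orbT.
by rewrite -setDIl H set0D eqxx !orbT.
Qed.

Section Insert.
Variables (A : {set T}) (x : T).
Hypothesis xA : x \notin A.

Lemma laminar_notin L I : laminar A L -> I \in L -> x \notin I.
Proof. by case/laminarP=> sub _ _ _ /sub[IA _]; apply: contra xA; apply/subsetP. Qed.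

(** Each node of [L] survives as a trace: with [x] added if it contains [J], unchanged otherwise.
    Conversely, removing [x] from a new node leaves a node of [L] or the empty set. *)
Lemma insert_leafK L J b : laminar A L -> J \in L ->
  delete_leaf x (insert_leaf x J b L) = L.
Proof.
move=> lamL JL; apply/setP=> I; rewrite !inE.
have [IL|IL] := boolP (I \in L).
  have xI := laminar_notin lamL IL; have xJ := laminar_notin lamL JL.
  have [sub _ _ _] := laminarP _ _ lamL; have [_ In0] := sub _ IL.
  rewrite eqxx (negbTE xI) In0 /= setU1K // IL.
  have -> : (J \subset x |: I) = (J \subset I).
    by rewrite -{2}(setU1K xI) subsetD1 xJ andbT.
  by case: (J \subset I); rewrite ?orbT.
rewrite eqxx /=; case: (boolP (x \in I)) => //= xI.
by rewrite setU1K // (negbTE IL) orbF; case: eqP.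
Qed.

(** The condition on [b] and [J] forbids giving a child to a leaf: with [b] false and [J = [set a]],
    the node [[set a]] would become [[set x; a]] and the leaf [a] would be lost. *)
Lemma insert_leaf_laminar L J b : laminar A L -> J \in L -> b || (1 < #|J|) ->
  laminar (x |: A) (insert_leaf x J b L).
Proof.
move=> lamL JL bJ; have [sub AL sing cod] := laminarP _ _ lamL.
have [JA Jn0] := sub _ JL; have [j jJ] := set0Pn _ Jn0.
apply/laminarP; split.
- move=> K; rewrite inE; case: ifP => xK.
    move=> H; split; last by apply/set0Pn; exists x.
    rewrite -(setD1K xK) setUS //; case/orP: H => [/eqP->|/andP[/sub[] //]].
    by rewrite sub0set.
  case/andP=> /sub[KA Kn0] _; split=> //.
  by apply: subset_trans KA (subsetUr _ _).
- rewrite inE setU11 setU1K // AL (subset_trans JA) ?orbT //.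
  exact: subsetUr.
- move=> a; rewrite !inE; case: eqVneq => [->|ax] /= aA.
    by rewrite setDv eqxx.
  rewrite sing //=.
  have [Ja|//] := boolP (J \subset [set a]).
  move: Ja; rewrite subset1 (negbTE Jn0) orbF => /eqP Ja.
  by move: bJ; rewrite Ja cards1 orbF eqxx andbT.
have mixed K1 K2 : K1 \in insert_leaf x J b L -> K2 \in insert_leaf x J b L ->
    x \in K1 -> x \notin K2 -> comparable_or_disjoint K1 K2.
  rewrite !inE => + + x1 x2; rewrite x1 (negbTE x2).
  case/orP=> [/eqP K10|/andP[I1 J1]] /andP[I2 J2].
    rewrite -(setD1K x1) K10 setU0 /comparable_or_disjoint.
    have -> : [set x] :&: K2 = set0 by apply/disjoint_setI0; rewrite disjoints1.
    by rewrite eqxx !orbT.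
  case/or3P: (cod _ _ I1 I2) => H.
  (* Here [K2] contains [J] but not [x], and the only such set in the new family is [J] itself. *)
  - have J2' : J \subset K2.
      by apply: subset_trans H; rewrite subsetD1 J1 (laminar_notin lamL JL).
    move: J2; rewrite J2' /= => /andP[_ /eqP->].
    by rewrite /comparable_or_disjoint J1 orbT.
  - by rewrite /comparable_or_disjoint (subset_trans H (subsetDl _ _)) orbT.
  rewrite /comparable_or_disjoint.
  suff -> : K1 :&: K2 = (K1 :\ x) :&: K2 by rewrite H !orbT.
  apply/setP=> y; rewrite !inE; case: eqVneq => // ->.
  by rewrite (negbTE x2) andbF.
move=> K1 K2 H1 H2.
have [x1|x1] := boolP (x \in K1); have [x2|x2] := boolP (x \in K2).
- move: H1 H2; rewrite !inE x1 x2 => H1 H2.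
  suff: (K1 :\ x \subset K2 :\ x) || (K2 :\ x \subset K1 :\ x).
    rewrite /comparable_or_disjoint -[in X in _ -> X](setD1K x1).
    rewrite -[in X in _ -> X](setD1K x2).
    by case/orP=> H; rewrite (setUS _ H) ?orbT.
  case/orP: H1 => [/eqP->|/andP[I1 J1]]; first by rewrite sub0set.
  case/orP: H2 => [/eqP->|/andP[I2 J2]]; first by rewrite sub0set orbT.
  (* Both [K1 :\ x] and [K2 :\ x] contain [J], so they share the point [j] and must be
     comparable. *)
  have jx : j != x by apply: contraNneq (laminar_notin lamL JL) => <-.
  have [||->|->] := comparable_or_disjoint_meet (a := j) (cod _ _ I1 I2).
  + by rewrite !inE jx (subsetP J1).
  + by rewrite !inE jx (subsetP J2).
  + by [].
  by rewrite orbT.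
- exact: mixed.
- by rewrite comparable_or_disjointC; apply: mixed.
by move: H1 H2; rewrite !inE (negbTE x1) (negbTE x2) => /andP[+ _] /andP[+ _]; apply: cod.
Qed.

(** Each node of [L] yields one set, with [x] added when it contains [J]. The extra sets are the
    leaf [[set x]] and, if [b] is true, the old node [J], kept below [x |: J]. *)
Lemma card_insert_leaf L J b : laminar A L -> J \in L ->
  #|insert_leaf x J b L| = (#|L| + b).+1.
Proof.
move=> lamL JL; have [sub _ _ _] := laminarP _ _ lamL.
have xJ := laminar_notin lamL JL.
have -> : insert_leaf x J b L =
    [set x] |: ([set x |: I | I in [set I in L | J \subset I]] :|:
      ([set I in L | ~~ (J \subset I)] :|: (if b then [set J] else set0))).
  apply/setP=> K; rewrite !inE.
  have -> : (K \in if b then [set J] else set0) = b && (K == J).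
    by case: b; rewrite inE.
  have [xK|xK] := boolP (x \in K).
    have -> : (K == [set x]) = (K :\ x == set0).
      apply/eqP/eqP => [->|K0]; first by rewrite setDv.
      by rewrite -(setD1K xK) K0 setU0.
    have -> : (K == J) = false by apply: contraNF xJ => /eqP <-.
    have -> : (K \in L) = false.
      by apply: contraTF xK; apply: laminar_notin lamL.
    rewrite /= andbF !orbF; congr (_ || _).
    apply/andP/imsetP => [[KL JK]|[I]].
      exists (K :\ x); last by rewrite setD1K.
      by rewrite inE KL subsetD1 JK xJ.
    rewrite inE => /andP[IL JI] ->.
    rewrite setU1K ?(laminar_notin lamL) // IL; split=> //.
    by apply: subset_trans JI (subsetUr _ _).
  have -> : (K == [set x]) = false.
    by apply: contraNF xK => /eqP ->; rewrite inE.
  have -> : (K \in [set x |: I | I in [set I in L | J \subset I]]) = false.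
    by apply: contraNF xK => /imsetP[I _ ->]; rewrite setU11.
  rewrite /= andb_orr; congr (_ || _).
  by rewrite andbCA; case: eqP => [->|]; rewrite ?JL ?andbT ?andbF.
have inj : {in [set I in L | J \subset I] &, injective (setU [set x])}.
  move=> I1 I2; rewrite !inE => /andP[L1 _] /andP[L2 _] e.
  by rewrite -(setU1K (laminar_notin lamL L1)) e setU1K // (laminar_notin lamL).
rewrite cardsU1 !inE.
have -> : [set x] \in L = false.
  by apply/negP => /(laminar_notin lamL); rewrite inE eqxx.
have -> : [set x] \in (if b then [set J] else set0) = false.
  by case: b; rewrite inE //; apply: contraNF xJ => /eqP <-; rewrite inE.
rewrite /= orbF.
have -> : [set x] \in [set x |: I | I in [set I in L | J \subset I]] = false.
  apply/negP=> /imsetP[I]; rewrite inE => /andP[IL _] e.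
  have [_ /negP[]] := sub _ IL.
  by rewrite -(setU1K (laminar_notin lamL IL)) -e setDv.
rewrite add1n; congr _.+1.
rewrite cardsU card_in_imset // disjoint_setI0 ?cards0 ?subn0; last first.
  rewrite -setI_eq0; apply/eqP/setP=> K; rewrite !inE.
  apply/negP=> /andP[/imsetP[I _ ->]] /orP[/andP[/(laminar_notin lamL)]|].
    by rewrite setU11.
  by case: b; rewrite inE // => /eqP e; move: xJ; rewrite -e setU11.
rewrite cardsU disjoint_setI0 ?cards0 ?subn0; last first.
  case: b; last by rewrite disjoint_sym disjoints_subset sub0set.
  by rewrite disjoint_sym disjoints1 inE subxx andbF.
rewrite addnA; congr (_ + _); last by case: b; rewrite ?cards1 ?cards0.
rewrite -(cardsID [set I : {set T} | J \subset I] L); congr (_ + _);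
  by apply: eq_card => I; rewrite !inE // andbC.
Qed.

(** Deleting [x] recovers [L]. Then [x |: J] is the parent of [x], the least node strictly above
    [[set x]], which determines [J]; and [b] records whether [J] is still a node. *)
Lemma insert_leaf_inj L1 J1 b1 L2 J2 b2 :
  laminar A L1 -> J1 \in L1 -> laminar A L2 -> J2 \in L2 ->
  insert_leaf x J1 b1 L1 = insert_leaf x J2 b2 L2 ->
  [/\ L1 = L2, J1 = J2 & b1 = b2].
Proof.
move=> lam1 JL1 lam2 JL2 e.
have eL : L1 = L2.
  by rewrite -(insert_leafK b1 lam1 JL1) e insert_leafK.
subst L2.
have x1 := laminar_notin lam1 JL1; have x2 := laminar_notin lam1 JL2.
have [sub _ _ _] := laminarP _ _ lam1.
have least J J' b b' : J \in L1 -> x \notin J -> x \notin J' ->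
  insert_leaf x J b L1 = insert_leaf x J' b' L1 -> J' \subset J.
  move=> JL xJ xJ' /setP/(_ (x |: J)).
  rewrite !inE eqxx /= setU1K // JL (negbTE (proj2 (sub _ JL))) subsetUr /=.
  by move/esym; rewrite -{2}(setU1K xJ) subsetD1 xJ' andbT.
have eJ : J1 = J2.
  by apply/eqP; rewrite eqEsubset !(least _ _ _ _ _ _ _ e, least _ _ _ _ _ _ _ (esym e)).
subst J2; split=> //.
move/setP: e => /(_ J1); rewrite !inE (negbTE x1) JL1 subxx eqxx /=.
by rewrite !andbT.
Qed.

(** Take for [J'] the parent of [x] in [L'], and set [J = J' :\ x]. The flag [b] is true exactly
    when [J] is itself a node, that is, when [x] has a single sibling. *)
Lemma insert_leaf_surj L' : A != set0 -> laminar (x |: A) L' ->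
  exists L J b, [/\ laminar A L, J \in L, b || (1 < #|J|)
                  & insert_leaf x J b L = L'].
Proof.
move=> An0 /laminarP[sub AL sing cod].
(* The root strictly contains [[set x]] because [A] is nonempty, so a minimal candidate for the
   parent exists. *)
have xA' : (x |: A \in L') && (x \in x |: A) && (x |: A != [set x]).
  rewrite AL setU11 /=; apply: contraNneq An0 => e.
  by rewrite -(setU1K xA) e setDv.
have [J' /andP[/andP[JL' xJ'] Jx] minJ] :=
  arg_minnP (P := fun I : {set T} => (I \in L') && (x \in I) && (I != [set x]))
            (fun I : {set T} => #|I|) xA'.
have least I : I \in L' -> x \in I -> I != [set x] -> J' \subset I.
  move=> IL xI Ix.
  have [//|IJ] := comparable_or_disjoint_meet (cod _ _ JL' IL) xJ' xI.
  have leJI : #|J'| <= #|I| by apply: minJ; rewrite IL xI.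
  by have /eqP-> : I == J' by rewrite eqEcard IJ.
pose J := J' :\ x.
have xJ : x \notin J by rewrite !inE eqxx.
have [j jJ] : exists j, j \in J.
  apply/set0Pn; apply: contraNneq Jx => J0.
  by rewrite -(setD1K xJ') -/J J0 setU0.
have jJ' : j \in J' by move: jJ; rewrite inE => /andP[].
have JinL : J \in delete_leaf x L'.
  by rewrite inE xJ setD1K // JL' orbT andbT; apply/set0Pn; exists j.
(* Such a [K] meets [J'] in [j] and cannot contain [J'], so it lies inside [J'] and avoids [x]. *)
have below K : K \in L' -> x \notin K -> J \subset K -> K = J.
  move=> KL xK JK; apply/eqP; rewrite eqEsubset JK andbT subsetD1 xK andbT.
  have jK := subsetP JK _ jJ.
  have [//|/subsetP/(_ _ xJ')] := comparable_or_disjoint_meet (cod _ _ KL JL') jK jJ'.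
  by rewrite (negbTE xK).
exists (delete_leaf x L'), J, (J \in L'); split=> //.
- apply/laminarP; split.
  + move=> I; rewrite inE => /and3P[xI In0 H]; split=> //.
    have : I \subset x |: A.
      case/orP: H => /sub[] // + _; apply: subset_trans.
      exact: subsetUr.
    by rewrite -{2}(setU1K xA) subsetD1 xI andbT.
  + by rewrite inE xA An0 AL orbT.
  + move=> a aA; rewrite !inE sing ?inE ?aA ?orbT // andbT.
    apply/andP; split; first by apply: contraNneq xA => ->.
    by apply/set0Pn; exists a; rewrite inE.
  move=> I1 I2; rewrite !inE => /and3P[x1 _ H1] /and3P[x2 _ H2].
  have pre I : x \notin I -> (I \in L') || (x |: I \in L') ->
      exists2 K, K \in L' & I = K :\ x.
    move=> xI /orP[H|H]; [exists I | exists (x |: I)] => //.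
      by apply/esym/setDidPl; rewrite disjoint_sym disjoints1.
    by rewrite setU1K.
  have [K1 L1 ->] := pre _ x1 H1; have [K2 L2 ->] := pre _ x2 H2.
  exact/comparable_or_disjointD1/cod.
(* If [J] is not a node it is not a singleton, since all singletons of points are nodes. *)
- have [//|JnL /=] := boolP (J \in L').
  rewrite ltnNge; apply: contra JnL => J1.
  have /eqP <- : [set j] == J by rewrite eqEcard sub1set jJ cards1.
  have [/subsetP jA _] := sub _ JL'; exact/sing/jA.
apply/setP=> K; rewrite inE.
have [xK|xK] := boolP (x \in K).
  rewrite !inE eqxx setD1K //=.
  have [K0|Kn0] /= := eqVneq (K :\ x) set0.
    by rewrite -(setD1K xK) K0 setU0 sing // setU11.
  have KJ : J \subset K -> J \subset K :\ x by rewrite subsetD1 xJ andbT.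
  apply/andP/idP => [[/orP[KL|//] /KJ JK]|KL].
    by rewrite -(setD1K xK) (below _ KL) ?inE ?eqxx // setD1K.
  rewrite KL orbT; split=> //; apply: subset_trans (subsetDl _ _) (least _ KL xK _).
  by apply: contraNneq Kn0 => ->; rewrite setDv.
rewrite inE xK /=.
apply/andP/idP => [[/andP[Kn0 KL]]|KL].
  case/orP=> [JK|/andP[JL /eqP-> //]].
  case/orP: KL => // KL; case/negP: JK.
  rewrite -(setU1K xK) setSD // least ?setU11 //.
  by apply: contraNneq Kn0 => e; rewrite -(setU1K xK) e setDv.
have [_ ->] := sub _ KL; rewrite KL; split=> //.
have [JK|//] := boolP (J \subset K).
by rewrite -(below _ KL xK JK) KL eqxx.
Qed.

End Insert.

(** * Counting laminar families by their number of nodes *)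

Definition laminar_family A l : {set {set {set T}}} :=
  [set L | laminar A L & #|L| == l].

Lemma laminar_singletons A L : laminar A L ->
  [set [set a] | a in A] = L :\: [set J in L | 1 < #|J|].
Proof.
case/laminarP=> sub _ sing _; apply/setP=> J; rewrite !inE.
apply/imsetP/idP => [[a aA ->]|]; first by rewrite sing // cards1.
case: (boolP (J \in L)) => [JL|]; last by rewrite andbF.
have [JA Jn0] := sub _ JL; rewrite -leqNgt andbT leq_eqVlt ltnS leqn0 cards_eq0.
rewrite (negbTE Jn0) orbF => /cards1P[a Ja]; exists a => //.
by rewrite -sub1set -Ja.
Qed.

(** The singletons in [L] are exactly the leaves, one for each point of [A]; the other nodes are the
    internal ones. *)
Lemma card_laminar_nonsingletons A L : laminar A L ->
  #|L| = #|A| + #|[set J in L | 1 < #|J|]|.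
Proof.
move=> lamL; rewrite -(card_imset _ (@set1_inj T)) (laminar_singletons lamL).
rewrite -(cardsID [set J in L | 1 < #|J|] L) addnC; congr (_ + #|pred_of_set _|).
by apply/setIidPr/subsetP => J; rewrite inE => /andP[].
Qed.

(** Insertion is a bijection from the disjoint union of [choices false] and [choices true]. In the
    first, [J] ranges over the [l.+1 - #|A|] internal nodes of a tree with [l.+1] nodes; in the
    second, over all nodes of a tree with [l] nodes. *)
Lemma card_laminar_family_step A x l : x \notin A -> A != set0 ->
  #|laminar_family (x |: A) l.+2| =
    (l.+1 - #|A|) * #|laminar_family A l.+1| + l * #|laminar_family A l|.
Proof.
move=> xA An0.
(* Insertion adds [1 + b] nodes, so a tree with [l.+2] nodes arises from one with [l.+1 - b]. *)
pose choices (b : bool) := [set p : {set {set T}} * {set T} |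
  (p.1 \in laminar_family A (l.+1 - b)) &&
  (p.2 \in [set J in p.1 | b || (1 < #|J|)])].
pose ins (b : bool) (p : {set {set T}} * {set T}) := insert_leaf x p.2 b p.1.
have lamE b p : p \in choices b ->
    [/\ laminar A p.1, #|p.1| = l.+1 - b, p.2 \in p.1 & b || (1 < #|p.2|)].
  by rewrite !inE => /andP[/andP[? /eqP ?] /andP[? ?]].
have eq_ins b1 p1 b2 p2 : p1 \in choices b1 -> p2 \in choices b2 ->
    ins b1 p1 = ins b2 p2 -> p1 = p2 /\ b1 = b2.
  move=> /lamE[l1 _ J1 _] /lamE[l2 _ J2 _] /(insert_leaf_inj xA l1 J1 l2 J2)[].
  by move: p1 p2 {l1 J1 l2 J2} => [? ?] [? ?] /= -> -> ->.
have card_im b : #|ins b @: choices b| = #|choices b|.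
  by apply: card_in_imset => p q pc qc /(eq_ins _ _ _ _ pc qc)[].
have card_ins b p : p \in choices b -> #|ins b p| = l.+2.
  case/lamE=> lam cp Jp _; rewrite (card_insert_leaf xA) // cp.
  by rewrite subnK //; case: (b).
have -> : laminar_family (x |: A) l.+2 =
    ins false @: choices false :|: ins true @: choices true.
  apply/setP=> L'; apply/idP/idP => [|].
    rewrite inE => /andP[/(insert_leaf_surj xA An0)[L [J [b [lam JL bJ <-]]]]].
    rewrite (card_insert_leaf xA) // => /eqP[cL].
    have pc : (L, J) \in choices b by rewrite !inE lam JL bJ -cL addnK eqxx.
    by move: (imset_f (ins b) pc); rewrite inE; case: b {bJ cL pc} => -> //; rewrite orbT.
  have im b p : p \in choices b -> ins b p \in laminar_family (x |: A) l.+2.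
    move=> pc; have [lam _ Jp bJ] := lamE _ _ pc.
    by rewrite inE card_ins // eqxx andbT insert_leaf_laminar.
  by case/setUP=> /imsetP[p pc ->]; apply: im.
rewrite cardsU disjoint_setI0 ?cards0 ?subn0 ?card_im; last first.
  rewrite -setI_eq0; apply/eqP/setP=> K; rewrite !inE.
  by apply/negP=> /andP[/imsetP[p pc ->] /imsetP[q qc] /(eq_ins _ _ _ _ pc qc)[]].
rewrite mulnC [l * _]mulnC; congr (_ + _).
  rewrite -(@card_dep_pairs _ _ _ (fun L => [set J in L | false || (1 < #|J|)])).
    by apply: eq_card => p; rewrite !inE subn0.
  move=> L; rewrite inE => /andP[/card_laminar_nonsingletons -> /eqP cL].
  by rewrite -cL addKn.
rewrite -(@card_dep_pairs _ _ _ (fun L => [set J in L | true || (1 < #|J|)])).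
  by apply: eq_card => p; rewrite !inE subn1.
move=> L; rewrite inE => /andP[_ /eqP <-].
by apply: eq_card => J; rewrite inE /= andbT.
Qed.

Lemma card_laminar_family0 A l : l < #|A| -> #|laminar_family A l| = 0.
Proof.
move=> lA; apply/eqP; rewrite cards_eq0; apply/eqP/setP=> L; rewrite !inE.
apply/negP=> /andP[/card_laminar_nonsingletons cL /eqP lL].
by move: lA; rewrite -lL cL ltnNge leq_addr.
Qed.

Lemma card_laminar_family1 a l : #|laminar_family [set a] l| = (l == 1).
Proof.
have lamE L : laminar [set a] L = (L == [set [set a]]).
  apply/laminarP/eqP => [[sub AL _ _]|->].
    apply/eqP; rewrite eqEsubset sub1set AL andbT.
    apply/subsetP=> I /sub[]; rewrite subset1 inE => /orP[//|/eqP->].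
    by rewrite eqxx.
  split=> [I|||I J]; rewrite ?inE //.
  - by move/eqP->; rewrite subxx -card_gt0 cards1.
  - by move=> b; rewrite !inE => /eqP->.
  by move=> /eqP-> /eqP->; rewrite /comparable_or_disjoint subxx.
case: eqP => [->|l1] /=.
  apply/eqP/cards1P; exists [set [set a]]; apply/setP=> L.
  by rewrite !inE lamE; case: eqP => // ->; rewrite cards1.
apply/eqP; rewrite cards_eq0; apply/eqP/setP=> L; rewrite !inE lamE.
by case: eqP => //= ->; rewrite cards1 eq_sym; apply/eqP.
Qed.

End Laminar.

(* Counts the partitions of an m-set into k blocks of size at least 2: removing a
   point leaves either such a partition with a marked block, or the partner of
   the point and a partition of the rest. *)
Fixpoint assoc_stirling2 (m k : nat) : nat :=
  match m with
  | 0 => k == 0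
  | m1.+1 => k * assoc_stirling2 m1 k +
      (if m1 is m2.+1 then (if k is k1.+1 then m1 * assoc_stirling2 m2 k1 else 0)
       else 0)
  end.

Lemma assoc_stirling2_0r m : assoc_stirling2 m.+1 0 = 0.
Proof. by case: m. Qed.

Lemma assoc_stirling2_step m k :
  assoc_stirling2 m.+2 k.+1 =
    k.+1 * assoc_stirling2 m.+1 k.+1 + m.+1 * assoc_stirling2 m k.
Proof. by []. Qed.

Lemma assoc_stirling2_small m k : m < k.*2 -> assoc_stirling2 m k = 0.
Proof.
elim/ltn_ind: m k => -[|[|m]] IH [|k] //; first by rewrite /= muln0.
rewrite doubleS !ltnS assoc_stirling2_step => mk.
by rewrite !IH ?muln0 // ?doubleS ltnS // ltnW.
Qed.

(** Here [k] is the number of internal nodes. The induction is on the number of leaves with [k]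
    arbitrary, since removing a leaf leaves [k] or [k - 1] internal nodes; the two recurrences then
    agree term by term. *)
Lemma card_laminar_family (T : finType) (A : {set T}) k : A != set0 ->
  #|laminar_family A (#|A| + k)| = assoc_stirling2 (#|A| + k).-1 k.
Proof.
move: {2}#|A|.-1 (erefl #|A|.-1) => n; elim: n A k => [|n IH] A k eA An0.
  have /cards1P[a ->] : #|A| == 1.
    by rewrite eqn_leq card_gt0 An0 andbT -subn_eq0 subn1 eA.
  rewrite card_laminar_family1 cards1 add1n eqSS /=.
  (* A single leaf admits no internal node; on the other side, [k.+1] points are too few for [k.+1]
     blocks of size at least 2. *)
  case: k => // k; rewrite assoc_stirling2_small // -addnn.
  by rewrite addSn ltnS leq_addl.
have [x xA] := set0Pn _ An0.
have cB : #|A :\ x| = n.+1 by rewrite -eA (cardsD1 x A) xA.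
have Bn0 : A :\ x != set0 by rewrite -card_gt0 cB.
rewrite -(setD1K xA) cardsU1 !inE eqxx /= cB add1n.
have IHB j : #|laminar_family (A :\ x) (n.+1 + j)| = assoc_stirling2 (n + j) j.
  by rewrite -[in LHS]cB IH ?cB.
case: k => [|k].
  rewrite addn0 card_laminar_family_step ?inE ?eqxx // cB subnn mul0n.
  (* Without internal nodes the first factor is 0, and the second term counts families with fewer
     sets than leaves. *)
  by rewrite [X in _ * X]card_laminar_family0 ?cB // muln0 assoc_stirling2_0r.
rewrite addnS !addSn card_laminar_family_step ?inE ?eqxx // cB -addSn.
by rewrite -[(n.+1 + k).+1]addnS !IHB addKn addnS assoc_stirling2_step.
Qed.

(** * Counting partitions into blocks of size at least 2 *)

Section Partitions.
Variable T : finType.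
Implicit Types (A B C D : {set T}) (P Q : {set {set T}}) (x : T).

Definition partitions2 D k : {set {set {set T}}} :=
  [set P | [&& partition P D, #|P| == k & [forall B in P, 1 < #|B|]]].

(** Adding the block [C] is inverse to deleting it; [C] is nonempty, so it is never already a block
    of a partition of [D :\: C]. *)
Lemma card_partitions2_block D C k : C \subset D -> 1 < #|C| ->
  #|[set P in partitions2 D k.+1 | C \in P]| = #|partitions2 (D :\: C) k|.
Proof.
move=> CD C2; have Cn0 : C != set0 by rewrite -card_gt0 ltnW.
have disC : [disjoint C & D :\: C] by rewrite -setI_eq0 setIDA setIC -setIDA setDv setI0.
have CnQ Q : Q \in partitions2 (D :\: C) k -> C \notin Q.
  rewrite inE => /and3P[parQ _ _]; apply/negP=> /(partitionS parQ) CDC.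
  by case/negP: Cn0; rewrite -subset0 -(disjoint_setI0 disC) subsetI subxx.
rewrite -[RHS](card_in_imset (f := setU [set C])); last first.
  by move=> Q1 Q2 H1 H2 e; rewrite -(setU1K (CnQ _ H1)) e setU1K // CnQ.
apply: eq_card => P; apply/idP/imsetP => [|[Q QP ->]].
  rewrite !inE => /andP[/and3P[parP /eqP cP /forall_inP P2] CP].
  exists (P :\ C); last by rewrite setD1K.
  rewrite inE partitionD1 //=.
  move: cP; rewrite (cardsD1 C) CP add1n => -[->]; rewrite eqxx.
  by apply/forall_inP=> B /setD1P[_ /P2].
have CQ := CnQ _ QP; move: QP; rewrite !inE eqxx => /and3P[parQ /eqP cQ /forall_inP Q2].
rewrite andbT -(setID D C) (setIidPr CD) partitionU1 //= cardsU1 CQ cQ add1n eqxx /=.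
by apply/forall_inP=> B /setU1P[->|/Q2].
Qed.

(** Double counting of partitions with a marked block [C]. *)
Lemma sum_partitions2_blocks A k :
  \sum_(C : {set T} | (C \subset A) && (1 < #|C|)) #|partitions2 (A :\: C) k| =
    k.+1 * #|partitions2 A k.+1|.
Proof.
rewrite mulnC -sum_nat_const.
rewrite (eq_bigr (fun C => \sum_(P in [set P in partitions2 A k.+1 | C \in P]) 1)); last first.
  by move=> C /andP[CA C2]; rewrite sum1_card card_partitions2_block.
rewrite [RHS](eq_bigr (fun P : {set {set T}} => \sum_(C in P) 1)); last first.
  by move=> P; rewrite inE sum1_card => /and3P[_ /eqP].
rewrite (exchange_big_dep (fun P => P \in partitions2 A k.+1)) /=; last first.
  by move=> C P _; rewrite inE => /andP[].
apply: eq_bigr => P PA; apply: eq_bigl => C; rewrite inE PA /=.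
rewrite andb_idl // => CP; move: PA; rewrite inE => /and3P[parP _ /forall_inP P2].
by rewrite (partitionS parP) // P2.
Qed.

(** Partitions are sorted by the block [x |: C] of [x]; [C] is nonempty because that block has at
    least two elements. *)
Lemma card_partitions2_step A x k : x \notin A ->
  #|partitions2 (x |: A) k.+1| =
    \sum_(C : {set T} | (C \subset A) && (C != set0)) #|partitions2 (A :\: C) k|.
Proof.
move=> xA; have xC C : C \subset A -> x \notin C.
  by move=> CA; apply: contra xA; apply/subsetP.
transitivity (\sum_(C : {set T} | (C \subset A) && (C != set0))
    #|[set P in partitions2 (x |: A) k.+1 | x |: C \in P]|); last first.
  apply: eq_bigr => C /andP[CA Cn0].
  rewrite card_partitions2_block ?setUS ?cardsU1 ?xC ?add1n ?ltnS ?card_gt0 //.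
  congr #|pred_of_set (partitions2 _ k)|; apply/setP=> y; rewrite !inE.
  by case: eqVneq => // -> /=; rewrite (negbTE xA) andbF.
rewrite -sum1_card; under [RHS]eq_bigr => C _ do rewrite -sum1_card.
rewrite (exchange_big_dep (fun P => P \in partitions2 (x |: A) k.+1)) /=; last first.
  by move=> C P _; rewrite inE => /andP[].
apply: eq_bigr => P PA; move: (PA); rewrite inE => /and3P[parP _ /forall_inP P2].
have xcov : x \in cover P by rewrite (cover_partition parP) setU11.
have xB : x \in pblock P x by rewrite mem_pblock.
have BP := pblock_mem xcov.
rewrite (big_pred1 (pblock P x :\ x)) // => C; rewrite inE PA /=.
apply/andP/eqP => [[/andP[CA Cn0] CP]|->].
  by rewrite (def_pblock (partition_trivIset parP) CP) ?setU11 // setU1K ?xC.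
rewrite setD1K // BP; split=> //; apply/andP; split.
  by rewrite -(setU1K xA) setSD // (partitionS parP).
by move: (P2 _ BP); rewrite (cardsD1 x) xB add1n ltnS card_gt0.
Qed.

(** The sum over [C] splits by size. The terms with at least two elements count the partitions of
    [B] with a marked block, which [x] joins; the singletons are the possible partners of [x] in a
    pair. *)
Lemma card_partitions2 A k : #|partitions2 A k| = assoc_stirling2 #|A| k.
Proof.
move: {2}#|A| (leqnn #|A|) => n; elim: n A k => [|n IH] A k.
  rewrite leqn0 cards_eq0 => /eqP->; rewrite cards0.
  have -> : partitions2 set0 k = if k == 0 then [set set0] else set0.
    apply/setP=> P; rewrite [LHS]inE partition_set0.
    have -> : (P \in if k == 0 then [set set0] else set0) = (P == set0) && (k == 0).
      by case: (k == 0); rewrite inE ?andbT ?andbF.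
    case: eqP => //= ->; rewrite cards0 eq_sym andb_idr // => _.
    by apply/forall_inP => B; rewrite inE.
  by case: k => [|k] /=; rewrite ?cards1 ?cards0.
have [->|An0] := eqVneq A set0; first by move=> _; apply: IH; rewrite cards0.
have [x xA] := set0Pn _ An0; rewrite (cardsD1 x) xA add1n ltnS => leB.
set B := A :\ x in leB *.
have xB : x \notin B by rewrite !inE eqxx.
have -> : A = x |: B by rewrite setD1K.
case: k => [|k].
  rewrite assoc_stirling2_0r; apply/eqP; rewrite cards_eq0; apply/eqP/setP=> P.
  rewrite !inE; apply/negP=> /and3P[parP]; rewrite cards_eq0 => /eqP P0 _.
  by move: (cover_partition parP) => /setP/(_ x); rewrite P0 /cover big_set0 !inE eqxx.
rewrite card_partitions2_step // (bigID (fun C : {set T} => 1 < #|C|)) /=.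
have -> : \sum_(C : {set T} | (C \subset B) && (C != set0) && (1 < #|C|))
    #|partitions2 (B :\: C) k| = k.+1 * #|partitions2 B k.+1|.
  rewrite -sum_partitions2_blocks; apply: eq_bigl => C.
  by rewrite -card_gt0 -andbA; congr (_ && _); apply: andb_idl => /ltnW.
rewrite IH //; congr (_ + _).
rewrite (eq_bigl (mem [set C : {set T} | (C \subset B) && (#|C| == 1)])); last first.
  by move=> C; rewrite !inE -andbA -card_gt0 -leqNgt eqn_leq [(0 < _) && _]andbC.
have H C : C \in [set C : {set T} | (C \subset B) && (#|C| == 1)] ->
    #|partitions2 (B :\: C) k| = assoc_stirling2 #|B|.-1 k.
  rewrite inE => /andP[CB /eqP C1].
  rewrite IH ?(leq_trans (subset_leq_card (subsetDl _ _)) leB) //.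
  by rewrite cardsD (setIidPr CB) C1 subn1.
rewrite (eq_bigr _ H) sum_nat_const cards_draws bin1.
(* Destructing [#|B|] reduces the inner match of [assoc_stirling2]; when [B] is empty both sides are
   0. *)
by case: #|B|.
Qed.

End Partitions.

(** * Nested sets as laminar families, and the bijection *)

(** Adding the [n] singletons is a bijection, inverted by intersecting with [P2 n]. As [n] is at
    least 2, the full set survives this intersection. *)
Lemma card_S2 n k : 1 < n -> #|S2 n k| = #|laminar_family [set: 'I_n] (n + k)|.
Proof.
move=> n2; pose singles : {set {set 'I_n}} := [set [set a] | a in [set: 'I_n]].
have singleP I : I \in singles = (#|I| == 1).
  by apply/imsetP/cards1P => [[a _ ->]|[a ->]]; exists a.
have addK S : S \in S2 n k -> (S :|: singles) :&: P2 n = S.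
  rewrite inE => /andP[/and3P[/subsetP SP2 _ _] _]; apply/setP=> I.
  rewrite !inE singleP; case: (boolP (I \in S)) => [/SP2|_] /=; first by rewrite inE.
  by case: eqP => // ->.
rewrite -[LHS](card_in_imset (f := fun S => S :|: singles)); last first.
  by move=> S1 S2 h1 h2 e; rewrite -(addK _ h1) e addK.
have card_singles : #|singles| = n by rewrite card_imset ?cardsT ?card_ord //; apply: set1_inj.
apply: eq_card => L; apply/imsetP/idP => [[S]|].
  rewrite inE => /andP[/and3P[SP2 TS /forall_inP cod] /eqP cS] ->.
  have {}SP2 I : I \in S -> 1 < #|I| by move/(subsetP SP2); rewrite inE.
  rewrite inE; apply/andP; split; last first.
    rewrite cardsU card_singles cS disjoint_setI0 ?cards0 ?subn0 1?addnC //.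
    rewrite -setI_eq0; apply/eqP/setP=> I; rewrite !inE singleP.
    by apply/negP=> /andP[/SP2 + /eqP I1]; rewrite I1.
  have cod1 a I : comparable_or_disjoint [set a] I.
    rewrite /comparable_or_disjoint sub1set setI_eq0 disjoints1.
    by case: (a \in I); rewrite ?orbT.
  apply/laminarP; split.
  - move=> I; rewrite subsetT !inE singleP -card_gt0 => /orP[/SP2/ltnW//|/eqP->//].
  - by rewrite inE TS.
  - by move=> a _; rewrite inE singleP cards1 eqxx orbT.
  move=> I J /setUP[IS|/imsetP[a _ ->]] // /setUP[JS|/imsetP[b _ ->]].
    exact: (forall_inP (cod _ IS)).
  by rewrite comparable_or_disjointC.
rewrite inE => /andP[lamL /eqP cL]; have [sub TL sing cod] := laminarP _ _ lamL.
have LE : L = (L :&: P2 n) :|: singles.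
  apply/setP=> I; rewrite !inE singleP.
  case: (boolP (I \in L)) => [IL|IL] /=.
    have [_] := sub _ IL; rewrite -card_gt0 leq_eqVlt eq_sym.
    by case/orP=> ->; rewrite ?orbT.
  by apply/esym; apply: contraNF IL => /cards1P[a ->]; apply: sing.
exists (L :&: P2 n) => //; rewrite inE; apply/andP; split.
  apply/and3P; split; first exact: subsetIr.
    by rewrite !inE TL cardsT card_ord.
  apply/forall_inP=> I /setIP[IL _]; apply/forall_inP=> J /setIP[JL _].
  exact: cod.
rewrite -(eqn_add2l n) -cL (card_laminar_nonsingletons lamL) cardsT card_ord.
by rewrite eqn_add2l; apply/eqP/eq_card=> I; rewrite !inE.
Qed.

Theorem theorem2p1 (n k : nat) (hn : 2 <= n) (hk : 1 <= k <= n - 1) :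
  exists f : {S : {set {set 'I_n}} | S \in S2 n k} ->
             {P : {set {set 'I_(n + k - 1)}} | P \in T2 (n + k - 1) k},
    bijective f.
Proof.
(* It remains to compare cardinals; both equal [assoc_stirling2 (n + k - 1) k]. *)
apply: card_eq_bijective; rewrite !card_sig.
transitivity #|S2 n k|; first by apply: eq_card.
transitivity #|T2 (n + k - 1) k|; last by apply: esym; apply: eq_card.
have nT : #|[set: 'I_n]| = n by rewrite cardsT card_ord.
have := @card_laminar_family _ [set: 'I_n] k; rewrite nT card_S2 // => ->.
  have := card_partitions2 [set: 'I_(n + k - 1)] k.
  by rewrite cardsT card_ord subn1 => <-.
by rewrite -card_gt0 nT ltnW.
Qed.
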